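(* Let $L$ be an algebraically split link in $S^3$. Then $$u^\Delta(L) \geq \frac{1}{2}\, u(L),$$ where $u^\Delta(L)$ is the $\Delta$-unlinking number of $L$ and $u(L)$ is the unlinking number of $L$.
   Context: An $m$-component link $L = L_1 \sqcup \cdots \sqcup L_m$ is the isotopy class of a (tame, equivalently smooth) embedding of a disjoint union of $m$ circles in $S^3$; a knot is a 1-component link. Links are ordered and oriented. $L$ is algebraically split if $lk(L_i,L_j)=0$ for all $i\neq j$, where $lk$ is the linking number. $\Delta$-move: a local change of a link diagram inside a disk $D$, leaving the diagram outside $D$ unchanged. Before the move, $D$ contains exactly three arcs $a,b,c$, each pair crossing exactly once, the three crossings bounding a triangle, with cyclic over/under information: $a$ passes over $b$, $b$ over $c$, and $c$ over $a$ (so the triangle is not one to which the Reidemeister III move applies). After the move, the arcs have the same endpoints and the same pairwise over/under relations, but one arc has been pushed across the crossing of the other two, so that the triangle is inverted. The three arcs may belong to any component(s) of the link, and the move may be applied to any diagram of the link. Two links are $\Delta$-equivalent if one can be deformed into the other by a finite sequence of $\Delta$-moves (and isotopies). It is known (Murakami–Nakanishi) that ordered oriented $m$-component links are $\Delta$-equivalent if and only if they have the same pairwise linking numbers, so every algebraically split link is $\Delta$-equivalent to the $m$-component trivial link. For an algebraically split $m$-component link $L$, the $\Delta$-unlinking number $u^\Delta(L)$ is the minimal number of $\Delta$-moves needed to deform $L$ into the $m$-component trivial link. The unlinking number $u(L)$ is the minimal number of crossing changes (between any components) needed to transform $L$ into the $m$-component trivial link. *)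

(* Defs.v *)
From HB Require Import structures.
From mathcomp Require Import all_boot all_order all_algebra.
From mathcomp Require Import all_classical all_reals all_analysis.
From mathcomp Require Import lra.

Set Implicit Arguments.
Unset Strict Implicit.
Unset Printing Implicit Defensive.

Import Order.TTheory GRing.Theory Num.Theory.
Import numFieldNormedType.Exports.

Local Open Scope classical_set_scope.
Local Open Scope ring_scope.

Definition homeomorphism (T U : topologicalType) (f : T -> U) : Prop :=
  exists g : U -> T, [/\ continuous f, continuous g, cancel f g & cancel g f].

Notation plane R := (R * R)%type.
Notation space3 R := (R * R * R)%type.
Notation S3 R := (one_point_compactification (R * R * R)%type).

Section Links.
Context {R : realType}.

Definition circle : set (plane R) := [set x | x.1 ^+ 2 + x.2 ^+ 2 = 1].

(* The disjoint union of m circles is the subset [circles m] of 'I_m * R^2;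
   maps are total on 'I_m * R^2 and only their values on [circles m] matter. *)
Definition circles (m : nat) : set ('I_m * plane R) := [set p | circle p.2].

Definition embedding (m : nat) (T : topologicalType)
    (f : 'I_m * plane R -> T) : Prop :=
  (forall i, {within circle, continuous (fun x => f (i, x))}) /\
  (forall p q, circles p -> circles q -> f p = f q -> p = q).

(* Since the circles are numbered and parametrized, links are ordered and
   oriented. Tameness is the separate predicate [tame] below. *)
Record link (m : nat) := Link {
  link_map :> 'I_m * plane R -> S3 R;
  link_embedding : embedding link_map }.

Definition isotopic (m : nat) (f g : 'I_m * plane R -> S3 R) : Prop :=
  exists H : R -> S3 R -> S3 R,
    [/\ {within `[0, 1] `*` setT, continuous (fun tx : R * S3 R => H tx.1 tx.2)},
        forall t : R, 0 <= t <= 1 -> homeomorphism (H t),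
        H 0 = id &
        forall p, circles p -> H 1 (f p) = g p].

Definition in_S3 (m : nat) (c : 'I_m * plane R -> space3 R) :
  'I_m * plane R -> S3 R := fun p => Some (c p).

Definition rotate (x : plane R) (s : R) : plane R :=
  (x.1 * cos s - x.2 * sin s, x.1 * sin s + x.2 * cos s).

Definition curve (m : nat) (c : 'I_m * plane R -> space3 R) (p : 'I_m * plane R)
  : R -> space3 R := fun s => c (p.1, rotate p.2 s).

Definition velocity (m : nat) (c : 'I_m * plane R -> space3 R)
    (p : 'I_m * plane R) : space3 R :=
  derive1 (curve c p) 0.

Definition smooth (m : nat) (c : 'I_m * plane R -> space3 R) : Prop :=
  (forall i n (s : R), derivable (derive1n n (curve c (i, (1, 0)))) s 1) /\
  (forall p, circles p -> velocity c p != 0).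

Definition tame (m : nat) (L : link m) : Prop :=
  exists2 c : 'I_m * plane R -> space3 R, smooth c & isotopic L (in_S3 c).

Definition shadow (m : nat) (c : 'I_m * plane R -> space3 R)
  (p : 'I_m * plane R) : plane R := (c p).1.

Definition height (m : nat) (c : 'I_m * plane R -> space3 R)
  (p : 'I_m * plane R) : R := (c p).2.

Definition crossing (m : nat) (c : 'I_m * plane R -> space3 R)
    (p q : 'I_m * plane R) : Prop :=
  [/\ circles p, circles q, p <> q & shadow c p = shadow c q].

Definition is_over (m : nat) (c : 'I_m * plane R -> space3 R)
  (p q : 'I_m * plane R) : bool := height c q < height c p.

(* In suitable topological coordinates of the plane, the two branches of the
   projection through the double point lie on the two coordinate axes. *)
Definition transverse (m : nat) (c : 'I_m * plane R -> space3 R)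
    (p q : 'I_m * plane R) : Prop :=
  exists phi : plane R -> plane R,
    [/\ homeomorphism phi,
        phi (0, 0) = shadow c p,
        \forall x \near within circle (nbhs p.2),
          exists s, shadow c (p.1, x) = phi (s, 0) &
        \forall x \near within circle (nbhs q.2),
          exists s, shadow c (q.1, x) = phi (0, s)].

Definition regular (m : nat) (c : 'I_m * plane R -> space3 R) : Prop :=
  [/\ finite_set [set pq | crossing c pq.1 pq.2],
      forall p q r, crossing c p q -> crossing c p r -> q = r &
      forall p q, crossing c p q -> transverse c p q].

(* A diagram is kept as a link in R^3 in general position: its shadow is the
   underlying plane curve, its heights give the over/under information. *)
Record diagram (m : nat) := Diagram {
  diagram_map :> 'I_m * plane R -> space3 R;
  diagram_embedding : embedding diagram_map;
  diagram_regular : regular diagram_map }.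

Definition cross (u v : plane R) : R := u.1 * v.2 - u.2 * v.1.

Definition crossing_sign (m : nat) (c : 'I_m * plane R -> space3 R)
    (p q : 'I_m * plane R) : R :=
  if is_over c p q then Num.sg (cross (velocity c p).1 (velocity c q).1)
  else Num.sg (cross (velocity c q).1 (velocity c p).1).

Definition smooth_diagram (m : nat) (d : diagram m) : Prop :=
  smooth d /\
  (forall p, circles p -> (velocity d p).1 != 0) /\
  (forall p q, crossing d p q -> cross (velocity d p).1 (velocity d q).1 != 0).

(* Half the sum of the signs of the crossings between components i and j;
   for i <> j each crossing is counted once, with its point on i first. *)
Definition diagram_lk (m : nat) (d : diagram m) (i j : 'I_m) : R :=
  2^-1 * \sum_(pq \in [set pq : ('I_m * plane R) * ('I_m * plane R) |
            [/\ crossing d pq.1 pq.2, pq.1.1 = i & pq.2.1 = j]])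
           crossing_sign d pq.1 pq.2.

Definition linking_number (m : nat) (L : link m) (i j : 'I_m) (n : R) : Prop :=
  exists d : diagram m,
    [/\ smooth_diagram d, isotopic L (in_S3 d) & diagram_lk d i j = n].

Definition algebraically_split (m : nat) (L : link m) : Prop :=
  forall i j : 'I_m, i <> j -> linking_number L i j 0.

(* Same projection, and the same over/under information except at one double
   point. Heights may otherwise vary: that does not affect the isotopy type. *)
Definition crossing_change (m : nat) (d d' : diagram m) : Prop :=
  (forall p, circles p -> shadow d' p = shadow d p) /\
  exists p0 q0, crossing d p0 q0 /\
    forall p q, crossing d p q ->
      is_over d' p q = is_over d p q (+) ((p, q) \in [:: (p0, q0); (q0, p0)]).

(* The disk of a Delta-move is the image phi @` square of the model disk under
   a homeomorphism phi of the plane. In the model, b and c run along the two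
   diagonals, which cross at (0, 0), and a runs from (-1, 0) to (1, 0), passing
   that crossing below (e = -1, before the move) or above (e = 1, after it).
   Composing phi with the symmetries of the square gives the inverse move and
   the move with the opposite cyclic arrangement. *)
Definition square : set (plane R) := [set x | `|x.1| <= 1 /\ `|x.2| <= 1].
Definition arc_a (e s : R) : plane R := (s, e * Num.max 0 (2^-1 - `|s|)).
Definition arc_b (s : R) : plane R := (s, s).
Definition arc_c (s : R) : plane R := (s, - s).

(* A strand (i, g) is the path s |-> (i, g s), -1 <= s <= 1, in the i-th
   circle, in either direction. *)
Definition strand_pt (m : nat) (a : 'I_m * (R -> plane R)) (s : R)
  : 'I_m * plane R := (a.1, a.2 s).

Definition traces (m : nat) (c : 'I_m * plane R -> space3 R)
    (a : 'I_m * (R -> plane R)) (A : R -> plane R) : Prop :=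
  {within `[-1, 1], continuous a.2} /\
  forall s : R, -1 <= s <= 1 ->
    circles (strand_pt a s) /\ shadow c (strand_pt a s) = A s.

Definition on_strand (m : nat) (a : 'I_m * (R -> plane R))
    (p : 'I_m * plane R) : Prop :=
  exists2 s : R, -1 <= s <= 1 & p = strand_pt a s.

Definition passes_over (m : nat) (c : 'I_m * plane R -> space3 R)
    (a b : 'I_m * (R -> plane R)) : Prop :=
  forall s t : R, -1 <= s <= 1 -> -1 <= t <= 1 ->
    shadow c (strand_pt a s) = shadow c (strand_pt b t) ->
    is_over c (strand_pt a s) (strand_pt b t).

Definition delta_tangle (m : nat) (d : diagram m) (phi : plane R -> plane R)
    (e : R) (a b c : 'I_m * (R -> plane R)) : Prop :=
  [/\ [/\ traces d a (phi \o arc_a e), traces d b (phi \o arc_b) &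
          traces d c (phi \o arc_c)],
      forall p, circles p -> (phi @` square) (shadow d p) ->
        [\/ on_strand a p, on_strand b p | on_strand c p] &
      [/\ passes_over d a b, passes_over d b c & passes_over d c a]].

Definition delta_move (m : nat) (d d' : diagram m) : Prop :=
  exists (phi : plane R -> plane R) (a b c : 'I_m * (R -> plane R)),
    [/\ homeomorphism phi,
        delta_tangle d phi (-1) a b c,
        delta_tangle d' phi 1 a b c &
        forall p, circles p ->
          ~ (exists2 s : R, -1 < s < 1 & p = strand_pt a s) -> d' p = d p].

(* The move may be made on any diagrams of the two isotopy classes. *)
Definition move_on_links (m : nat) (mv : diagram m -> diagram m -> Prop)
    (L L' : link m) : Prop :=
  exists d d' : diagram m,
    [/\ isotopic L (in_S3 d), mv d d' & isotopic L' (in_S3 d')].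

Fixpoint deforms_in (m : nat) (mv : diagram m -> diagram m -> Prop) (n : nat)
    (L L' : link m) : Prop :=
  if n is n'.+1 then
    exists2 L1 : link m, move_on_links mv L L1 & deforms_in mv n' L1 L'
  else isotopic L L'.

Definition unlink_map (m : nat) (p : 'I_m * plane R) : S3 R :=
  Some ((3 * (p.1 : nat)%:R + p.2.1, p.2.2), 0).

Lemma unlink_embedding (m : nat) : embedding (@unlink_map m).
Proof.
split=> [i|[i x] [j y]] /=.
  apply: continuous_subspaceT => x.
  have c1 : (fun x : plane R => 3 * (i : nat)%:R + x.1) @ x -->
      3 * (i : nat)%:R + x.1 by apply: cvgD; [exact: cvg_cst | exact: cvg_fst].
  have c2 : snd @ x --> x.2 by exact: cvg_snd.
  have c3 : (fun=> 0 : R) @ x --> (0 : R) by exact: cvg_cst.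
  apply: (cvg_comp _ (Some : space3 R -> S3 R) (cvg_pair (cvg_pair c1 c2) c3)).
  exact: one_point_compactification_some_continuous.
rewrite /circles /circle /= => xS yS [e1 e2].
have bnd (z : plane R) : z.1 ^+ 2 + z.2 ^+ 2 = 1 -> -1 <= z.1 <= 1.
  by move=> zS; apply/andP; split; nra.
have := bnd _ xS; have := bnd _ yS => /andP[y1 y2] /andP[x1 x2].
have gap (k l : 'I_m) : (k < l)%N -> (k : nat)%:R + 1 <= (l : nat)%:R :> R.
  by move=> kl; rewrite natr1 ler_nat.
have ij : i = j.
  by apply/val_inj; case: (ltngtP i j) => // /gap ?; exfalso; lra.
move: e1; rewrite ij => /addrI e1; congr (_, _).
by rewrite [x]surjective_pairing [y]surjective_pairing e1 e2.
Qed.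

Definition unlink (m : nat) : link m := Link (@unlink_embedding m).

(* The infimum is +oo when no sequence of moves leads to the trivial link;
   otherwise it is the least number of moves. *)
Definition least_moves (m : nat) (mv : diagram m -> diagram m -> Prop)
    (L : link m) : \bar R :=
  ereal_inf [set (n%:R)%:E | n in [set n | deforms_in mv n L (unlink m)]].

Definition unlinking_number (m : nat) (L : link m) : \bar R :=
  least_moves (@crossing_change m) L.

Definition delta_unlinking_number (m : nat) (L : link m) : \bar R :=
  least_moves (@delta_move m) L.

End Links.
Arguments link R m : clear implicits.
Arguments diagram R m : clear implicits.

(* Main.v *)
Require Import Defs.
From mathcomp Require Import all_boot all_order all_algebra.
From mathcomp Require Import all_classical all_reals all_analysis.
From mathcomp Require Import ring lra.

(* A Delta-move amounts to two crossing changes. In the triangle with a over b,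
   b over c and c over a, a crossing change between a and c puts a over both b
   and c; then a can be slid across the crossing of b and c by an isotopy, and a
   second crossing change between a and c restores the cyclic arrangement.
   The isotopy preserves heights and is supported over the disk of the move,
   above b and c; in the model square it acts on every vertical segment by
   Moebius maps, so that no regularity of the disk's chart is needed. *)

Set Implicit Arguments.
Unset Strict Implicit.
Unset Printing Implicit Defensive.

Import Order.TTheory GRing.Theory Num.Theory.
Import numFieldNormedType.Exports.

Local Open Scope classical_set_scope.
Local Open Scope ring_scope.

(** * The isotopy of the model square *)

Section SquareTwist.
Context {R : realType}.
Implicit Types (c k s y : R) (x : plane R).

(** Clamping positions and parameters to [-1, 1] makes the maps below total in all real
    arguments. *)
Definition clamp y : R := Num.max (-1) (Num.min 1 y).

Lemma clamp_id y : `|y| <= 1 -> clamp y = y.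
Proof. by rewrite ler_norml /clamp => /andP[? ?]; rewrite min_r// max_r. Qed.

Lemma clamp_bound y : -1 <= clamp y <= 1.
Proof.
have N11 : -1 <= 1 :> R by lra.
by rewrite /clamp le_max lexx ge_max ge_min lexx N11.
Qed.

Lemma clampN y : clamp (- y) = - clamp y.
Proof.
have [y1|y1] := leP 1 y.
  by rewrite /clamp (@min_l _ _ 1 y)// (@min_r _ _ 1) ?(@max_l _ _ _ (- y))
       ?max_r//; lra.
have [y0|y0] := leP (-1) y.
  by rewrite !clamp_id// ?normrN ler_norml; lra.
by rewrite /clamp (@min_r _ _ 1 y) 1?(@min_l _ _ 1 (- y)) ?(@max_l _ _ _ y)
     ?max_r ?opprK//; lra.
Qed.

Lemma clamp_sat y : 1 <= `|y| -> clamp y ^+ 2 = 1.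
Proof.
rewrite ler_normr /clamp => /orP[] ?; last first.
  by rewrite min_r ?max_l ?sqrrN ?expr1n//; lra.
by rewrite min_l ?max_r ?expr1n//; lra.
Qed.

(* On [-1, 1] this is the Moebius map y |-> (y + c) / (1 + c y) (relativistic
   addition of velocities), whose inverse is the same map for - c. *)
Definition slide c y : R :=
  y + c * (1 - clamp y ^+ 2) / (1 + c * clamp y).

Lemma slide_out c y : 1 <= `|y| -> slide c y = y.
Proof.
by move=> /clamp_sat; rewrite /slide => ->; rewrite subrr mulr0 mul0r addr0.
Qed.

Lemma slide0 y : slide 0 y = y.
Proof. by rewrite /slide !mul0r addr0. Qed.

Lemma slide_den c y : `|c| < 1 -> `|y| <= 1 -> 0 < 1 + c * y.
Proof.
move=> c1 y1; have : `|c * y| < 1 by rewrite normrM; have := normr_ge0 c; nra.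
by rewrite ltr_norml; lra.
Qed.

Lemma slide_in c y : `|c| < 1 -> `|y| <= 1 -> slide c y = (y + c) / (1 + c * y).
Proof.
move=> c1 y1; have := slide_den c1 y1 => d0.
by rewrite /slide clamp_id//; field; rewrite gt_eqF.
Qed.

Lemma slide_norm c y : `|c| < 1 -> `|y| <= 1 -> `|slide c y| <= 1.
Proof.
move=> c1 y1; have d0 := slide_den c1 y1; rewrite slide_in// ler_norml.
move: c1 y1; rewrite ltr_norml ler_norml => /andP[? ?] /andP[? ?].
by rewrite ler_pdivlMr// ler_pdivrMr//; apply/andP; split; nra.
Qed.

Lemma slideK c : `|c| < 1 -> cancel (slide c) (slide (- c)).
Proof.
move=> c1 y; have [y1|y1] := leP `|y| 1; last by rewrite !slide_out// ltW.
have c1' : `|- c| < 1 by rewrite normrN.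
have d0 := slide_den c1 y1; have s1 := slide_norm c1 y1.
have := slide_den c1' s1; rewrite (slide_in c1')//.
rewrite slide_in// => d1; field.
(* Once [1 + c * y] is cleared, the denominator of the second slide is [1 - c ^+ 2]. *)
rewrite gt_eqF//= gt_eqF// (_ : _ + _ = (1 - c) * (1 + c)); last by ring.
by move: c1; rewrite ltr_norml => /andP[? ?]; apply: mulr_gt0; lra.
Qed.

Definition arc_gap s : R := Num.max 0 (2^-1 - `|s|).

Lemma arc_gap_bound s : 0 <= arc_gap s <= 2^-1.
Proof.
rewrite /arc_gap le_max lexx/= ge_max invr_ge0 ler0n /=.
by have := normr_ge0 s; lra.
Qed.

(* The solution h of (h - g) / (1 - h g) = g for g = arc_gap s: sliding by it
   takes the lower arc to the upper one. *)
Definition slide_speed s : R := 2 * arc_gap s / (1 + arc_gap s ^+ 2).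

(** With [g = arc_gap s <= 1/2], [1 - 2 * g / (1 + g ^+ 2)] equals [(1 - g) ^+ 2 / (1 + g ^+ 2)],
    which is positive. Strictness keeps the Moebius maps invertible. *)
Lemma slide_speed_lt1 k s : `|clamp k * slide_speed s| < 1.
Proof.
have /andP[k0 k1] := clamp_bound k.
have /andP[g0 g1] := arc_gap_bound s.
rewrite normrM.
have w0 : 0 <= slide_speed s by rewrite divr_ge0//; nra.
have w1 : slide_speed s < 1 by rewrite ltr_pdivrMr; nra.
have : `|clamp k| <= 1 by rewrite ler_norml k0 k1.
by rewrite (ger0_norm w0); have := normr_ge0 (clamp k); nra.
Qed.

(** The parameter [k] is the time of the isotopy: the identity at 0, and at 1 a map carrying the
    lower arc to the upper one. *)
Definition twist k x : plane R := (x.1, slide (clamp k * slide_speed x.1) x.2).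

Lemma twist0 : twist 0 = id.
Proof.
apply/funext => -[x y]; rewrite /twist/= clamp_id ?normr0//.
by rewrite mul0r slide0.
Qed.

Lemma twistK k : cancel (twist k) (twist (- k)).
Proof.
move=> [x y]; rewrite /twist /= clampN mulNr slideK//.
exact: slide_speed_lt1.
Qed.

Lemma twist_gap0 k x : arc_gap x.1 = 0 -> twist k x = x.
Proof.
by case: x => x y /= g0; rewrite /twist/= /slide_speed g0 mulr0 mul0r mulr0 slide0.
Qed.

(** The speed vanishes on the vertical lines with [|x| >= 1/2], and slides fix every [y] with
    [|y| >= 1]. *)
Lemma twist_out k x : ~ square x -> twist k x = x.
Proof.
case: x => x y sq; have [x1|x1] := leP `|x| 1; last first.
  by apply: twist_gap0; rewrite /arc_gap/= max_l//; lra.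
have [y1|y1] := leP `|y| 1; first by case: sq; split.
by rewrite /twist/= slide_out// ltW.
Qed.

Lemma twist_arc_a s : twist 1 (arc_a (-1) s) = arc_a 1 s.
Proof.
rewrite /twist/arc_a/= -/(arc_gap s) clamp_id ?normr1// mul1r mulN1r mul1r.
have /andP[g0 g1] := arc_gap_bound s.
rewrite slide_in; last 2 first.
- by have := slide_speed_lt1 1 s; rewrite clamp_id ?normr1// mul1r.
- by rewrite normrN ger0_norm//; lra.
by congr (_, _); rewrite /slide_speed; field; apply/andP; split; apply/eqP => ?; nra.
Qed.

Lemma clamp_continuous : continuous clamp.
Proof.
move=> y; apply: (@continuous_max _ _ (fun=> -1) (fun y => Num.min 1 y)).
  exact: cvg_cst.
by apply: (@continuous_min _ _ (fun=> 1) id); [exact: cvg_cst|exact: cvg_id].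
Qed.

Lemma arc_gap_continuous : continuous arc_gap.
Proof.
move=> y; apply: (@continuous_max _ _ (fun=> 0) (fun y => 2^-1 - `|y|)).
  exact: cvg_cst.
by apply: cvgB; [exact: cvg_cst|apply: cvg_norm; exact: cvg_id].
Qed.

Lemma twist_continuous : continuous (fun kx : R * plane R => twist kx.1 kx.2).
Proof.
move=> [k [x y]].
have c1 : (fun kx : R * plane R => kx.2.1) @ (k, (x, y)) --> x.
  by apply: (@cvg_comp _ _ _ snd fst); [exact: cvg_snd|exact: cvg_fst].
have c2 : (fun kx : R * plane R => kx.2.2) @ (k, (x, y)) --> y.
  by apply: (@cvg_comp _ _ _ snd snd); exact: cvg_snd.
have ck : (fun kx : R * plane R => clamp kx.1) @ (k, (x, y)) --> clamp k.
  by apply: (@cvg_comp _ _ _ fst clamp); [exact: cvg_fst|exact: clamp_continuous].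
have cg : (fun kx : R * plane R => arc_gap kx.2.1) @ (k, (x, y)) --> arc_gap x.
  apply: (@cvg_comp _ _ _ (fun kx : R * plane R => kx.2.1) arc_gap _ _ _ c1).
  exact: arc_gap_continuous.
have cy : (fun kx : R * plane R => clamp kx.2.2) @ (k, (x, y)) --> clamp y.
  apply: (@cvg_comp _ _ _ (fun kx : R * plane R => kx.2.2) clamp _ _ _ c2).
  exact: clamp_continuous.
have cw : (fun kx : R * plane R => clamp kx.1 * slide_speed kx.2.1)
    @ (k, (x, y)) --> clamp k * slide_speed x.
  apply: cvgM => //; apply: cvgM.
    by apply: cvgM => //; exact: cvg_cst.
  apply: cvgV; first by apply/eqP => ?; nra.
  by apply: cvgD; [exact: cvg_cst|apply: cvgM].
have cs : (fun kx : R * plane R => slide (clamp kx.1 * slide_speed kx.2.1) kx.2.2)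
    @ (k, (x, y)) --> slide (clamp k * slide_speed x) y.
  apply: cvgD => //; apply: cvgM.
    apply: cvgM => //; apply: cvgB; first exact: cvg_cst.
    exact: cvgM.
  apply: cvgV.
    rewrite gt_eqF// slide_den//; first exact: slide_speed_lt1.
    by rewrite ler_norml clamp_bound.
  by apply: cvgD; [exact: cvg_cst|exact: cvgM].
exact: cvg_pair c1 cs.
Qed.

End SquareTwist.

(** * Compactly supported isotopies of space, extended to the 3-sphere *)

Definition opc_map (T : topologicalType) (f : T -> T) :
  one_point_compactification T -> one_point_compactification T := omap f.

(** At a finite point this is continuity of [G]. At infinity, [G] is the identity off [C] for all
    parameters at once, so the part of a neighbourhood of infinity lying off [C] is mapped into that
    neighbourhood. *)
Lemma opc_map_continuous {R : realType} (T : topologicalType)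
    (G : R -> T -> T) (C : set T) :
    compact C -> closed C ->
    continuous (fun cx : R * T => G cx.1 cx.2) ->
    (forall c x, ~ C x -> G c x = x) ->
  continuous (fun cx : R * one_point_compactification T => opc_map (G cx.1) cx.2).
Proof.
move=> Ccpt Ccl Gc Gout [c [x|]] A /= nA.
  have [[P Q] /= [cP xQ] PQ] := Gc (c, x) _ nA.
  exists (P, Some @` Q).
    by split=> //; exact: one_point_compactification_some_nbhs.
  by move=> [s _] [/= Ps [y Qy <-]]; exact: (PQ (s, y)).
have nC : nbhs (None : one_point_compactification T)
    (Some @` (~` C) `|` [set None]) by exists C.
exists (setT, (Some @` (~` C) `|` [set None]) `&` A).
  split; first exact: (@filterT _ (nbhs c)).
  exact: (@filterI _ (nbhs (None : one_point_compactification T))).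
move=> [s [x|]] [_ [/= xC Ax]] //=.
by case: xC => [[y Cy [yx]]|//]; rewrite Gout// -yx.
Qed.

Lemma opc_map_homeomorphism {R : realType} (T : topologicalType)
    (G : R -> T -> T) (C : set T) :
    compact C -> closed C ->
    continuous (fun cx : R * T => G cx.1 cx.2) ->
    (forall c x, ~ C x -> G c x = x) -> (forall c, cancel (G c) (G (- c))) ->
  forall c, homeomorphism (opc_map (G c)).
Proof.
move=> Ccpt Ccl Gc Gout GK c.
have ct (s : R) : continuous (opc_map (G s)).
  move=> x.
  have sx : (fun y : one_point_compactification T => (s, y)) @ x --> (s, x).
    apply: (@cvg_pair _ _ _ (nbhs x) (nbhs s) (nbhs x) _ _ _ (fun=> s) id).
      exact: cvg_cst.
    exact: cvg_id.
  move=> A nA; have nsx := opc_map_continuous Ccpt Ccl Gc Gout (x := (s, x)) nA.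
  exact (sx _ nsx).
have opcK (s : R) : cancel (opc_map (G s)) (opc_map (G (- s))).
  by case=> [x|] //=; rewrite GK.
exists (opc_map (G (- c))); split => // x.
by have := opcK (- c) x; rewrite opprK.
Qed.

Lemma compact_support_isotopic {R : realType} (m : nat)
    (G : R -> space3 R -> space3 R) (C : set (space3 R))
    (f g : 'I_m * plane R -> space3 R) :
    compact C -> closed C ->
    continuous (fun cx : R * space3 R => G cx.1 cx.2) ->
    (forall c x, ~ C x -> G c x = x) -> (forall c, cancel (G c) (G (- c))) ->
    G 0 = id -> (forall p, circles p -> G 1 (f p) = g p) ->
  isotopic (in_S3 f) (in_S3 g).
Proof.
move=> Ccpt Ccl Gc Gout GK G0 G1; exists (fun c => opc_map (G c)); split.
- exact/continuous_subspaceT/(opc_map_continuous Ccpt Ccl Gc Gout).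
- by move=> t _; exact: opc_map_homeomorphism Ccpt Ccl Gc Gout GK t.
- by rewrite G0; apply/funext; case.
- by move=> p cp; rewrite /in_S3 /= G1.
Qed.

Lemma isotopic_refl {R : realType} (m : nat) (f : 'I_m * plane R -> S3 R) :
  isotopic f f.
Proof.
exists (fun=> id); split => //.
  by apply: continuous_subspaceT => x; exact: cvg_snd.
by move=> _ _; exists id; split => // x; exact: cvg_id.
Qed.

(** * The ambient isotopy over the disk of the move *)

Section Push.
Context {R : realType}.
Variables (phi phi' : plane R -> plane R) (K : R).
Hypotheses (phi_continuous : continuous phi) (phi'_continuous : continuous phi').
Hypotheses (phiK : cancel phi phi') (phi'K : cancel phi' phi).

(** A tent with peak at height [K + 1] and support [[K, K + 2]]: it leaves everything at height at
    most [K] in place and makes the support of the isotopy compact. *)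
Definition ridge (z : R) : R := Num.max 0 (1 - `|z - (K + 1)|).

Definition push (c : R) (x : space3 R) : space3 R :=
  (phi (twist (c * ridge x.2) (phi' x.1)), x.2).

(** The third alternative serves the outer parts of the strand a, where the lower and upper arcs
    coincide and the height is neither at most [K] nor equal to [K + 1] in general. *)
Lemma push_fixed c x :
  ~ square (phi' x.1) \/ x.2 <= K \/ arc_gap (phi' x.1).1 = 0 ->
  push c x = x.
Proof.
case: x => u z; rewrite /push /= => -[out|[low|gap]].
- by rewrite twist_out// phi'K.
- rewrite /ridge max_l ?mulr0 ?twist0 ?phi'K//.
  by rewrite ler0_norm; lra.
- by rewrite twist_gap0// phi'K.
Qed.

Lemma push0 : push 0 = id.
Proof. by apply/funext => -[u z]; rewrite /push /= mul0r twist0 phi'K. Qed.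

Lemma pushK c : cancel (push c) (push (- c)).
Proof. by move=> [u z]; rewrite /push /= phiK mulNr twistK phi'K. Qed.

Lemma push_top (u : plane R) : push 1 (u, K + 1) = (phi (twist 1 (phi' u)), K + 1).
Proof. by rewrite /push /= /ridge subrr normr0 subr0 max_r// mulr1. Qed.

Lemma ridge_continuous : continuous ridge.
Proof.
move=> y; apply: (@continuous_max _ _ (fun=> 0) (fun y => 1 - `|y - (K + 1)|)).
  exact: cvg_cst.
apply: cvgB; first exact: cvg_cst.
by apply: cvg_norm; apply: cvgB; [exact: cvg_id|exact: cvg_cst].
Qed.

Lemma push_continuous : continuous (fun cx : R * space3 R => push cx.1 cx.2).
Proof.
move=> [c [u z]].
have cu : (fun cx : R * space3 R => cx.2.1) @ (c, (u, z)) --> u.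
  by apply: (@cvg_comp _ _ _ snd fst); [exact: cvg_snd|exact: cvg_fst].
have cz : (fun cx : R * space3 R => cx.2.2) @ (c, (u, z)) --> z.
  by apply: (@cvg_comp _ _ _ snd snd); exact: cvg_snd.
have ck : (fun cx : R * space3 R => cx.1 * ridge cx.2.2) @ (c, (u, z)) -->
    c * ridge z.
  apply: cvgM; first exact: cvg_fst.
  apply: (@cvg_comp _ _ _ (fun cx : R * space3 R => cx.2.2) ridge _ _ _ cz).
  exact: ridge_continuous.
have cv : (fun cx : R * space3 R => phi' cx.2.1) @ (c, (u, z)) --> phi' u.
  apply: (@cvg_comp _ _ _ (fun cx : R * space3 R => cx.2.1) phi' _ _ _ cu).
  exact: phi'_continuous.
have ct : (fun cx : R * space3 R => twist (cx.1 * ridge cx.2.2) (phi' cx.2.1))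
    @ (c, (u, z)) --> twist (c * ridge z) (phi' u).
  exact: (@cvg_comp _ _ _
    (fun cx : R * space3 R => (cx.1 * ridge cx.2.2, phi' cx.2.1))
    (fun kx => twist kx.1 kx.2) _ _ _ (cvg_pair ck cv)
    (@twist_continuous R (c * ridge z, phi' u))).
have cp : (fun cx : R * space3 R => phi (twist (cx.1 * ridge cx.2.2) (phi' cx.2.1)))
    @ (c, (u, z)) --> phi (twist (c * ridge z) (phi' u)).
  by apply: (@cvg_comp _ _ _ _ phi _ _ _ ct); exact: phi_continuous.
exact: cvg_pair cp cz.
Qed.

Lemma square_compact : compact (square : set (plane R)).
Proof.
rewrite (_ : square = `[-1, 1] `*` `[-1, 1]).
  by apply: compact_setX; exact: segment_compact.
by apply/seteqP; split => -[x y] /=; rewrite /square/= !in_itv/= !ler_norml.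
Qed.

Lemma space3_hausdorff : hausdorff_space (space3 R).
Proof. exact: norm_hausdorff. Qed.

Lemma push_isotopic (m : nat) (f g : 'I_m * plane R -> space3 R) :
  (forall p, circles p -> push 1 (f p) = g p) -> isotopic (in_S3 f) (in_S3 g).
Proof.
move=> fg.
have Ccpt : compact ((phi @` square) `*` `[K, K + 2]).
  apply: compact_setX; last exact: segment_compact.
  apply: continuous_compact square_compact.
  exact: continuous_subspaceT.
apply: (compact_support_isotopic Ccpt _ push_continuous _ pushK push0 fg).
  exact: compact_closed space3_hausdorff Ccpt.
move=> c [u z] nC; have [sq|sq] := pselect (square (phi' u)); last first.
  by apply: push_fixed; left.
have [zK|zK] := leP z K; first by apply: push_fixed; right; left.
have [zK2|zK2] := leP z (K + 2).
  case: nC; split=> /=; first by exists (phi' u).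
  by rewrite in_itv/= zK2 ltW.
rewrite /push /= /ridge max_l ?mulr0 ?twist0 ?phi'K//.
by rewrite ger0_norm; lra.
Qed.

End Push.

(** * Crossings of the model arcs, and basic facts on diagrams *)

Lemma sqr1_pm {R : realType} (e : R) : e ^+ 2 = 1 -> e = 1 \/ e = -1.
Proof. by move=> /eqP; rewrite sqrf_eq1 => /orP[] /eqP; [left|right]. Qed.

(** On the diagonal [s = e * (1/2 - |s|)], so [s] has the sign of [e]; the flat parts of the arc
    miss the diagonal. *)
Lemma arc_a_meets_b {R : realType} (e s t : R) :
  e ^+ 2 = 1 -> arc_a e s = arc_b t -> s = e / 4.
Proof.
move=> /sqr1_pm e1 [<-]; case: (leP 0 (2^-1 - `|s|)) => g; last first.
  by rewrite mulr0 => s0; move: g; rewrite -s0 normr0; lra.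
by case: e1 => ->; case: (ger0P s) => ? ?; lra.
Qed.

(** Reflection in the horizontal axis exchanges the two diagonals and the two signs of [e]. *)
Lemma arc_a_meets_c {R : realType} (e s t : R) :
  e ^+ 2 = 1 -> arc_a e s = arc_c t -> s = - (e / 4) /\ t = - (e / 4).
Proof.
move=> e2 [<-]; have e2' : (- e) ^+ 2 = 1 by rewrite sqrrN.
move=> es; have /(arc_a_meets_b e2') -> : arc_a (- e) s = arc_b s.
  by rewrite /arc_a mulNr es opprK.
by rewrite mulNr.
Qed.

Lemma within_fst (T U V : topologicalType) (A : set T) (f : T -> U * V) :
  {within A, continuous f} -> {within A, continuous (fun x => (f x).1)}.
Proof.
move=> /subspace_continuousP fc; apply/subspace_continuousP => x Ax.
have c1 : (fst : U * V -> U) @ nbhs (f x) --> (f x).1.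
  by case: (f x) => u v; exact: cvg_fst.
exact: cvg_comp (fc x Ax) c1.
Qed.

Lemma within_snd (T U V : topologicalType) (A : set T) (f : T -> U * V) :
  {within A, continuous f} -> {within A, continuous (fun x => (f x).2)}.
Proof.
move=> /subspace_continuousP fc; apply/subspace_continuousP => x Ax.
have c2 : (snd : U * V -> V) @ nbhs (f x) --> (f x).2.
  by case: (f x) => u v; exact: cvg_snd.
exact: cvg_comp (fc x Ax) c2.
Qed.

Lemma shadow_continuous {R : realType} (m : nat) (d : diagram R m) i :
  {within circle, continuous (fun x => shadow d (i, x))}.
Proof. exact: within_fst ((diagram_embedding d).1 i). Qed.

Lemma height_continuous {R : realType} (m : nat) (d : diagram R m) i :
  {within circle, continuous (fun x => height d (i, x))}.
Proof. exact: within_snd ((diagram_embedding d).1 i). Qed.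

Lemma crossing_sym {R : realType} (m : nat) (d : diagram R m) p q :
  crossing d p q -> crossing d q p.
Proof. by move=> [cp cq pq sh]; split => //; exact: nesym. Qed.

(** The two points of a crossing share their shadow, so injectivity of the diagram forces distinct
    heights. *)
Lemma is_over_sym {R : realType} (m : nat) (d : diagram R m) p q :
  crossing d p q -> is_over d q p = ~~ is_over d p q.
Proof.
move=> [cp cq pq sh]; rewrite /is_over -leNgt le_eqVlt.
suff /negbTE -> : height d p != height d q by [].
apply/eqP => hpq; apply: pq; apply: (diagram_embedding d).2 => //.
by rewrite [d p]surjective_pairing [d q]surjective_pairing; congr pair.
Qed.

(** * Raising the strand a, before or after the move, is a crossing change *)

Section Raise.
Context {R : realType} {m : nat}.
Variables (phi phi' : plane R -> plane R).
Hypothesis phiK : cancel phi phi'.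
Variables (a b c : 'I_m * (R -> plane R)) (e K : R).
Hypothesis e2 : e ^+ 2 = 1.
Variables (d : diagram R m) (h : 'I_m * plane R -> R).
Hypothesis tangle : delta_tangle d phi e a b c.
Hypothesis h_continuous : forall i, {within circle, continuous (fun x => h (i, x))}.
Hypothesis h_off : forall p, circles p ->
  ~ (exists2 s : R, -1 < s < 1 & p = strand_pt a s) -> h p = height d p.
Hypothesis h_top : forall s, `|s| <= 2^-1 -> h (strand_pt a s) = K + 1.
Hypothesis low_b : forall s, -1 <= s <= 1 -> height d (strand_pt b s) <= K.
Hypothesis low_c : forall s, -1 <= s <= 1 -> height d (strand_pt c s) <= K.

(** The crossings of a with b and c sit at parameters [e / 4] and [- (e / 4)], well inside the part
    raised to [K + 1]. *)
Let quarter_bound (s : R) : s = e / 4 \/ s = - (e / 4) ->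
  -1 <= s <= 1 /\ `|s| <= 2^-1.
Proof.
by move=> es; rewrite ler_norml; case: (sqr1_pm e2) es => -> [] ->; split; lra.
Qed.

(** A common point would pass strictly over itself. *)
Lemma disjoint_a_b s t : -1 <= s <= 1 -> -1 <= t <= 1 ->
  strand_pt a s <> strand_pt b t.
Proof.
move=> s1 t1 st; case: tangle => _ _ [/(_ s t s1 t1) over _ _].
by move: over; rewrite st /is_over ltxx => /(_ erefl).
Qed.

Lemma disjoint_a_c s t : -1 <= s <= 1 -> -1 <= t <= 1 ->
  strand_pt a s <> strand_pt c t.
Proof.
move=> s1 t1 st; case: tangle => _ _ [_ _ /(_ t s t1 s1) over].
by move: over; rewrite st /is_over ltxx => /(_ erefl).
Qed.

(** The partner [q] has its shadow in the disk, hence lies on one of the three strands. It is not on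
    a, whose shadow is injective, and the model arcs locate it on b or c. *)
Lemma crossings_on_a s q : -1 <= s <= 1 -> crossing d (strand_pt a s) q ->
  (s = e / 4 /\ exists2 t, -1 <= t <= 1 & q = strand_pt b t) \/
  (s = - (e / 4) /\ q = strand_pt c (- (e / 4))).
Proof.
move=> s1 [_ cq sq shq]; case: tangle => -[[_ ta] [_ tb] [_ tc]] tD _.
have [_ sa] := ta s s1.
have qa : phi (arc_a e s) = shadow d q by rewrite -shq sa.
have /(tD _ cq) : (phi @` square) (shadow d q).
  exists (arc_a e s) => //; split => /=; first by rewrite ler_norml.
  have /andP[? ?] := arc_gap_bound s.
  have -> : `|e * arc_gap s| = arc_gap s.
    by case: (sqr1_pm e2) => ->; rewrite ?mulN1r ?mul1r ?normrN ger0_norm.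
  by lra.
case=> -[t t1 qt]; move: qa; rewrite qt.
- have [_ ->] := ta t t1 => /(can_inj phiK) [st _].
  by case: sq; rewrite qt st.
- have [_ ->] := tb t t1 => /(can_inj phiK) /(arc_a_meets_b e2) ->.
  by left; split=> //; exists t.
- have [_ ->] := tc t t1 => /(can_inj phiK) /(arc_a_meets_c e2) [-> ->].
  by right.
Qed.

(** Only heights change. With [e = -1] this applies to the diagram before the move, with [e = 1] to
    the one after it. *)
Definition raise (p : 'I_m * plane R) : space3 R := (shadow d p, h p).

Lemma raise_off p : circles p -> ~ on_strand a p -> h p = height d p.
Proof.
move=> cp off; apply: h_off => // -[s /andP[s0 s1] ps]; apply: off.
by exists s => //; rewrite !ltW.
Qed.

(** The partner is on b or c, off a, so it keeps its height, at most [K]; the point of a is at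
    [K + 1]. *)
Lemma raise_over p q : on_strand a p -> crossing d p q -> h q < h p.
Proof.
move=> [s s1 ->] cr; have [_ cq _ _] := cr.
have qK : h q <= K.
  case: (crossings_on_a s1 cr) => [[_ [t t1 qt]]|[_ qt]].
    rewrite raise_off// qt; first exact: low_b.
    by move=> [u u1 /esym/disjoint_a_b]; exact.
  have t1 : -1 <= - (e / 4) <= 1 by apply: (quarter_bound _).1; right.
  rewrite raise_off// qt; first exact: low_c.
  by move=> [u u1 /esym/disjoint_a_c]; exact.
rewrite h_top; first by lra.
by apply: (quarter_bound _).2; case: (crossings_on_a s1 cr) => -[-> _]; [left|right].
Qed.

(** A coincidence would be a crossing of [d]. If it involves a, the heights differ by [raise_over];
    otherwise the heights are those of [d]. *)
Lemma raise_embedding : embedding raise.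
Proof.
have [_ dinj] := diagram_embedding d; split=> [i|p q cp cq [shpq hpq]].
  apply/subspace_continuousP => x cx.
  have sx : shadow d (i, y) @[y --> within circle (nbhs x)] --> shadow d (i, x).
    exact: (subspace_continuousP _ _).1 (@shadow_continuous R m d i) x cx.
  have hx : h (i, y) @[y --> within circle (nbhs x)] --> h (i, x).
    exact: (subspace_continuousP _ _).1 (@h_continuous i) x cx.
  exact: cvg_pair sx hx.
have [//|/eqP pq] := eqVneq p q; exfalso.
have cr : crossing d p q by [].
have cr' : crossing d q p by split => //; exact: nesym.
have [ap|ap] := pselect (on_strand a p).
  by have := raise_over ap cr; rewrite hpq ltxx.
have [aq|aq] := pselect (on_strand a q).
  by have := raise_over aq cr'; rewrite hpq ltxx.
apply: pq; apply: dinj => //.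
rewrite [d p]surjective_pairing [d q]surjective_pairing.
by move: hpq; rewrite !raise_off// => hpq; congr pair.
Qed.

(** Regularity depends on the shadow alone, so that of [d] is reused by conversion. *)
Definition raised_diagram : diagram R m :=
  @Diagram R m raise raise_embedding (diagram_regular d).

(** The strand a already passes over b, so raising it alters only its single crossing with c. *)
Lemma raise_crossing_change : crossing_change d raised_diagram.
Proof.
have [[[_ ta] [_ tb] [_ tc]] _ [oab _ oca]] := tangle.
have e4 : -1 <= - (e / 4) <= 1 by case: (sqr1_pm e2) => ->; lra.
have e40 : e / 4 <> - (e / 4) by case: (sqr1_pm e2) => -> ?; lra.
set p0 := strand_pt a (- (e / 4)); set q0 := strand_pt c (- (e / 4)).
have [cp0 sp0] := ta _ e4; have [cq0 sq0] := tc _ e4.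
have p0q0 : p0 <> q0 by exact: disjoint_a_c.
have arcs : arc_a e (- (e / 4)) = arc_c (- (e / 4)).
  rewrite /arc_a /arc_c; congr pair.
  case: (sqr1_pm e2) => ->.
    by rewrite normrN ger0_norm ?max_r//; lra.
  by rewrite mulN1r opprK ger0_norm ?max_r//; lra.
split=> //; exists p0, q0; split; first by split => //; rewrite sp0 sq0 /= arcs.
(* Flipping the crossing [(p0, q0)] in [d] puts a on top everywhere. The point [q0] is not on b,
   since b passes over c. *)
have onA p q : on_strand a p -> crossing d p q ->
    is_over d p q (+) ((p, q) \in [:: (p0, q0); (q0, p0)]) = true.
  move=> [s s1 ps] cr; have cr' := cr; rewrite ps in cr'.
  have -> : (p, q) \in [:: (p0, q0); (q0, p0)] = (q == q0).
    rewrite !inE !xpair_eqE (_ : (p == q0) = false) ?orbF.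
      case: (q =P q0) => [qq0|_]; last by rewrite andbF.
      rewrite andbT; apply/eqP; rewrite ps.
      case: (crossings_on_a s1 cr') => [[_ [t t1 qt]]|[-> //]].
      case: tangle => _ _ [_ /(_ t (- (e / 4)) t1 e4) obc _].
      by move: obc; rewrite -qt -/q0 qq0 /is_over ltxx => /(_ erefl).
    by apply/eqP; rewrite ps; exact: disjoint_a_c.
  have [_ _ _ sh] := cr.
  case: (crossings_on_a s1 cr') => [[se [t t1 qt]]|[se qq0]].
    rewrite (_ : (q == q0) = false) ?addbF.
      by move: sh; rewrite ps qt; exact: oab.
    apply/eqP; rewrite qt => qq0.
    case: tangle => _ _ [_ /(_ t (- (e / 4)) t1 e4) obc _].
    by move: obc; rewrite qq0 /is_over ltxx => /(_ erefl).
  rewrite qq0 eqxx addbT -is_over_sym -?qq0//.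
  have sh' : shadow d q0 = shadow d (strand_pt a s) by rewrite -ps sh qq0.
  by rewrite qq0 ps; exact: oca.
have liftA p q : on_strand a p -> crossing d p q ->
    is_over raised_diagram p q = true.
  by move=> ap cr; exact: raise_over ap cr.
move=> p q cr; have rc := crossing_sym cr.
have [ap|ap] := pselect (on_strand a p); first by rewrite onA// liftA.
(* The exceptional list is symmetric, so this reduces to the previous case with [p] and [q]
   exchanged. *)
have [aq|aq] := pselect (on_strand a q).
  have := onA _ _ aq rc; have := liftA _ _ aq rc.
  rewrite is_over_sym// (is_over_sym cr) !inE !xpair_eqE.
  rewrite orbC [(p == q0) && _]andbC [(p == p0) && _]andbC.
  by move=> /negbTE -> /=; case: (is_over d p q) => /=; case: (_ || _).
have [cp cq _ _] := cr.
rewrite (_ : (p, q) \in _ = false) ?addbF; last first.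
  by apply/negP; rewrite !inE !xpair_eqE => /orP[] /andP[/eqP ? /eqP ?];
    [apply: ap|apply: aq]; exists (- (e / 4)).
by rewrite /is_over /height/= !raise_off.
Qed.

End Raise.

Lemma crossing_change_sym {R : realType} (m : nat) (d d' : diagram R m) :
  crossing_change d d' -> crossing_change d' d.
Proof.
move=> [sh [p0 [q0 [cr0 over]]]].
have crE p q : crossing d p q <-> crossing d' p q.
  by split=> -[cp cq pq]; rewrite -?sh// => ?; split; rewrite // ?sh// -?sh.
split=> [p cp|]; first by rewrite sh.
exists p0, q0; split; first exact/crE.
by move=> p q /crE /over ->; rewrite -addbA addbb addbF.
Qed.

(** * A continuous weight along the strand a, and bounds on heights *)

Definition plateau {R : realType} (s : R) : R :=
  Num.max 0 (Num.min 1 (2 - 2 * `|s|)).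

Lemma plateau_ge0 {R : realType} (s : R) : 0 <= plateau s.
Proof. by rewrite /plateau le_max lexx. Qed.

Lemma plateau_top {R : realType} (s : R) : `|s| <= 2^-1 -> plateau s = 1.
Proof. by move=> s2; rewrite /plateau min_l ?max_r//; lra. Qed.

Lemma plateau_end {R : realType} (s : R) : 1 <= `|s| -> plateau s = 0.
Proof. by move=> s1; rewrite /plateau max_l// ge_min; apply/orP; right; lra. Qed.

Lemma plateau_continuous {R : realType} : continuous (@plateau R).
Proof.
move=> y; apply: (@continuous_max _ _ (fun=> 0) (fun s => Num.min 1 (2 - 2 * `|s|))).
  exact: cvg_cst.
apply: (@continuous_min _ _ (fun=> 1)); first exact: cvg_cst.
apply: cvgB; first exact: cvg_cst.
by apply: cvgM; [exact: cvg_cst|apply: cvg_norm; exact: cvg_id].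
Qed.

Lemma trace_compact {R : realType} (m : nat) (d : diagram R m) a A :
  traces d a A -> compact (a.2 @` `[-1, 1]).
Proof. by move=> [ac _]; exact: continuous_compact ac (@segment_compact _ _ _). Qed.

Lemma trace_circle {R : realType} (m : nat) (d : diagram R m) a A :
  traces d a A -> a.2 @` `[-1, 1] `<=` circle.
Proof.
by move=> [_ ta] _ [s /= s1 <-]; rewrite in_itv/= in s1; have [] := ta s s1.
Qed.

Lemma on_strand_closed {R : realType} (m : nat) (d : diagram R m) a A i :
  traces d a A -> closed [set x | on_strand a (i, x)].
Proof.
move=> ta; have [->|ai] := eqVneq i a.1.
  rewrite (_ : [set x | _] = a.2 @` `[-1, 1]).
    by apply: compact_closed (trace_compact ta); exact: norm_hausdorff.
  apply/seteqP; split => x /=.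
    by move=> [s s1 [->]]; exists s => //=; rewrite in_itv.
  by move=> [s]; rewrite in_itv/= => s1 <-; exists s.
rewrite (_ : [set x | _] = set0); first exact: closed0.
by apply/seteqP; split => x //= [s _ [ia _]]; case/eqP: ai.
Qed.

Lemma height_strand_bound {R : realType} (m : nat) (d : diagram R m) a A :
  traces d a A ->
  exists K : R, forall s, -1 <= s <= 1 -> height d (strand_pt a s) <= K.
Proof.
move=> ta.
have hc : {within a.2 @` `[-1, 1], continuous (fun x => height d (a.1, x))}.
  exact: continuous_subspaceW (trace_circle ta) (@height_continuous R m d a.1).
have cpt := continuous_compact hc (trace_compact ta).
have [M [_ MA]] := @compact_bounded R R^o _ cpt.
(* [compact_bounded] makes a bound of every real strictly above [M]. *)
exists (M + 1) => s s1; apply: le_trans (ler_norm _) _.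
apply: MA; first by rewrite ltrDl.
by exists (a.2 s) => //; exists s => //=; rewrite in_itv.
Qed.

Section StrandWeight.
Context {R : realType} {m : nat}.
Variables (phi phi' : plane R -> plane R).
Hypothesis phi'_continuous : continuous phi'.
Hypotheses (phiK : cancel phi phi') (phi'K : cancel phi' phi).
Variables (a b c : 'I_m * (R -> plane R)) (e : R).
Hypothesis e2 : e ^+ 2 = 1.
Variable d : diagram R m.
Hypothesis tangle : delta_tangle d phi e a b c.

(** The first coordinate of [arc_a e s] is [s], so the parameter of a point of a is read off from
    its shadow, without inverting the strand. *)
Definition strand_weight (p : 'I_m * plane R) : R :=
  if `[< on_strand a p >] then plateau (phi' (shadow d p)).1 else 0.

Lemma strand_weight_on s : -1 <= s <= 1 -> strand_weight (strand_pt a s) = plateau s.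
Proof.
move=> s1; rewrite /strand_weight asboolT; last by exists s.
by case: tangle => -[[_ /(_ s s1) [_ ->]] _ _] _ _; rewrite /= phiK.
Qed.

Lemma strand_weight_off p :
  ~ (exists2 s : R, -1 < s < 1 & p = strand_pt a s) -> strand_weight p = 0.
Proof.
move=> off; have [[s s1 ps]|ap] := pselect (on_strand a p); last first.
  by rewrite /strand_weight asboolF.
rewrite ps strand_weight_on// plateau_end// leNgt; apply/negP.
by rewrite ltr_norml => s1'; apply: off; exists s.
Qed.

Let near_within_notin (S : set (plane R)) x : closed S -> ~ S x ->
  \forall y \near within circle (nbhs x), ~ S y.
Proof.
move=> Scl Sx; have : nbhs x (~` S).
  by apply: open_nbhs_nbhs; split => //; exact: closed_openC.
by apply: filterS => y Sy _.
Qed.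

Lemma strand_weight_continuous i :
  {within circle, continuous (fun x => strand_weight (i, x))}.
Proof.
have [[ta tb tc] tD _] := tangle.
apply/subspace_continuousP => x cx; rewrite /from_subspace.
have cF : ProperFilter (within circle (nbhs x)).
  by apply: within_nbhs_proper; exact: subset_closure.
have phic : phi' (shadow d (i, y)) @[y --> within circle (nbhs x)] -->
    phi' (shadow d (i, x)).
  apply: (@cvg_comp _ _ _ (fun y => shadow d (i, y)) phi'); last first.
    exact: phi'_continuous.
  exact: (subspace_continuousP _ _).1 (@shadow_continuous R m d i) x cx.
have phic1 : (phi' (shadow d (i, y))).1 @[y --> within circle (nbhs x)] -->
    (phi' (shadow d (i, x))).1.
  apply: (cvg_comp _ _ phic); case: (phi' _) => u v; exact: cvg_fst.
have phic2 : (phi' (shadow d (i, y))).2 @[y --> within circle (nbhs x)] -->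
    (phi' (shadow d (i, x))).2.
  apply: (cvg_comp _ _ phic); case: (phi' _) => u v; exact: cvg_snd.
have bc : plateau (phi' (shadow d (i, y))).1 @[y --> within circle (nbhs x)]
    --> plateau (phi' (shadow d (i, x))).1.
  by apply: (cvg_comp _ _ phic1); exact: plateau_continuous.
(* Off the closed set of points of a, the weight is locally 0. *)
have [[s s1 xs]|ax] := pselect (on_strand a (i, x)); last first.
  have -> : strand_weight (i, x) = 0 by rewrite /strand_weight asboolF.
  apply: cvg_near_cst.
  have := near_within_notin (on_strand_closed ta) ax.
  by apply: filterS => y ay; rewrite /strand_weight asboolF.
have sx : phi' (shadow d (i, x)) = arc_a e s.
  by rewrite xs; case: ta => _ /(_ s s1) [_ ->]; rewrite /= phiK.
rewrite xs strand_weight_on//; rewrite sx /= in bc.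
(* At an end of a, the weight is squeezed between 0 and a plateau tending to 0. *)
have [s1'|s1'] := leP 1 `|s|.
  rewrite (plateau_end s1') in bc *.
  apply: (@squeeze_cvgr _ _ _ _ (fun=> 0)
    (fun y => plateau (phi' (shadow d (i, y))).1)) => //; last exact: cvg_cst.
  apply: nearW => y; rewrite /strand_weight.
  by case: asboolP => _; rewrite ?lexx plateau_ge0.
(* At an inner point of a, nearby points have their shadow in the disk and avoid b and c, so they
   lie on a and the weight is the plateau itself. *)
apply: cvg_trans bc; apply: near_eq_cvg.
have n1 : \forall y \near within circle (nbhs x), `|(phi' (shadow d (i, y))).1| < 1.
  by apply: (cvgr_norm_lt _ phic1); rewrite sx.
have n2 : \forall y \near within circle (nbhs x), `|(phi' (shadow d (i, y))).2| < 1.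
  apply: (cvgr_norm_lt _ phic2); rewrite sx /= -/(arc_gap s).
  have /andP[g0 g1] := arc_gap_bound s.
  have -> : `|e * arc_gap s| = arc_gap s.
    by case: (sqr1_pm e2) => ->; rewrite ?mulN1r ?mul1r ?normrN ger0_norm.
  by lra.
have bx : ~ on_strand b (i, x).
  by rewrite xs => -[t t1]; exact: (disjoint_a_b tangle).
have cx' : ~ on_strand c (i, x).
  by rewrite xs => -[t t1]; exact: (disjoint_a_c tangle).
have nb := near_within_notin (on_strand_closed tb) bx.
have nc := near_within_notin (on_strand_closed tc) cx'.
have cn : \forall y \near within circle (nbhs x), circle y by exact: withinT.
near=> y.
rewrite /strand_weight asboolT//.
have cy : circles (i, y) by change (circle y); near: y.
have sq : (phi @` square) (shadow d (i, y)).
  by exists (phi' (shadow d (i, y))) => //; split; apply: ltW; near: y.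
have yb : ~ on_strand b (i, y) by near: y.
have yc : ~ on_strand c (i, y) by near: y.
by case: (tD _ cy sq).
Unshelve. all: by end_near. Qed.

End StrandWeight.

(** * A Delta-move as two crossing changes *)

Lemma delta_move_two_crossing_changes {R : realType} (m : nat) (d d' : diagram R m) :
  delta_move d d' -> exists d1 d1' : diagram R m,
    [/\ crossing_change d d1, isotopic (in_S3 d1) (in_S3 d1') &
        crossing_change d1' d'].
Proof.
move=> [phi [a [b [c [[phi' [phic phi'c phiK phi'K]] tangle tangle' same]]]]].
have [[ta tb tc] tD _] := tangle; have [[ta' _ _] _ _] := tangle'.
have e2 : (-1 : R) ^+ 2 = 1 by rewrite sqrrN expr1n.
have e2' : (1 : R) ^+ 2 = 1 by rewrite expr1n.
have [Kb low_b] := height_strand_bound tb; have [Kc low_c] := height_strand_bound tc.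
pose K := Num.max Kb Kc.
have {}low_b s : -1 <= s <= 1 -> height d (strand_pt b s) <= K.
  by move=> s1; rewrite le_max low_b.
have {}low_c s : -1 <= s <= 1 -> height d (strand_pt c s) <= K.
  by move=> s1; rewrite le_max low_c// orbT.
pose w := strand_weight phi' a d.
(* Interpolation between the old height (weight 0) and [K + 1] (weight 1). *)
pose h p := height d p + w p * (K + 1 - height d p).
have h_continuous i : {within circle, continuous (fun x => h (i, x))}.
  apply/subspace_continuousP => x cx; rewrite /from_subspace.
  have hx := (subspace_continuousP _ _).1 (@height_continuous R m d i) x cx.
  have wx := (subspace_continuousP _ _).1
    (@strand_weight_continuous _ _ _ _ phi'c phiK phi'K _ _ _ _ e2 _ tangle i) x cx.
  by apply: cvgD => //; apply: cvgM => //; apply: cvgB => //; exact: cvg_cst.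
have h_off p : circles p -> ~ (exists2 s : R, -1 < s < 1 & p = strand_pt a s) ->
    h p = height d p.
  by move=> _ off; rewrite /h /w (strand_weight_off phiK tangle off) mul0r addr0.
have h_top s : `|s| <= 2^-1 -> h (strand_pt a s) = K + 1.
  move=> s2; have s1 : -1 <= s <= 1 by rewrite -ler_norml; lra.
  by rewrite /h /w (strand_weight_on phiK tangle s1) plateau_top// mul1r subrKC.
(* Since [d'] agrees with [d] off the interior of a, the same [h] raises a in [d']. *)
have h_off' p : circles p -> ~ (exists2 s : R, -1 < s < 1 & p = strand_pt a s) ->
    h p = height d' p.
  by move=> cp off; rewrite h_off// /height same.
have low_b' s : -1 <= s <= 1 -> height d' (strand_pt b s) <= K.
  move=> s1; rewrite /height same; [exact: low_b|exact: (tb.2 s s1).1|].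
  move=> [t /andP[t0 t1] /esym].
  by apply: (disjoint_a_b tangle) => //; rewrite !ltW.
have low_c' s : -1 <= s <= 1 -> height d' (strand_pt c s) <= K.
  move=> s1; rewrite /height same; [exact: low_c|exact: (tc.2 s s1).1|].
  move=> [t /andP[t0 t1] /esym].
  by apply: (disjoint_a_c tangle) => //; rewrite !ltW.
exists (raised_diagram phiK e2 tangle h_continuous h_off h_top low_b low_c).
exists (raised_diagram phiK e2' tangle' h_continuous h_off' h_top low_b' low_c').
split; first exact: raise_crossing_change; last first.
  exact/crossing_change_sym/raise_crossing_change.
apply: (push_isotopic (K := K) phic phi'c phiK phi'K) => p cp /=; rewrite /raise.
(* On the middle of a, at height [K + 1], the push is the full twist from lower to upper arc. On the
   outer parts the arcs coincide and nothing moves. Points off a are outside the disk, or on b or c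
   at height at most [K]. *)
have [[s s1 ->]|ap] := pselect (on_strand a p).
  have [_ ->] := ta.2 s s1; have [_ ->] := ta'.2 s s1.
  rewrite /comp; have [s2|s2] := leP `|s| 2^-1.
    by rewrite h_top// push_top phiK twist_arc_a.
  have g0 : arc_gap s = 0 by rewrite /arc_gap max_l//; lra.
  rewrite push_fixed//; last by right; right; rewrite phiK.
  by rewrite /arc_a -/(arc_gap s) g0 !mulr0.
have off : ~ (exists2 s : R, -1 < s < 1 & p = strand_pt a s).
  by move=> [s /andP[s0 s1] ps]; apply: ap; exists s => //; rewrite !ltW.
rewrite /shadow same// -/(shadow d p) push_fixed//=.
have [sq|] := pselect (square (phi' (shadow d p))); last by left.
right; left; rewrite h_off//.
have /(tD _ cp) : (phi @` square) (shadow d p) by exists (phi' (shadow d p)).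
by case=> // -[s s1 ->]; [exact: low_b|exact: low_c].
Qed.

(** * Counting the moves *)

Lemma in_S3_embedding {R : realType} (m : nat) (d : diagram R m) :
  embedding (in_S3 d).
Proof.
have [dc dinj] := diagram_embedding d; split=> [i|p q cp cq [/dinj]]; last exact.
apply/subspace_continuousP => x cx.
have sc : (Some : space3 R -> S3 R) @ nbhs (d (i, x)) --> (Some (d (i, x)) : S3 R).
  exact: one_point_compactification_some_continuous.
exact: cvg_comp ((subspace_continuousP _ _).1 (dc i) x cx) sc.
Qed.

Lemma deforms_crossing_of_delta {R : realType} (m n : nat) (L L' : link R m) :
  deforms_in (@delta_move R m) n L L' ->
  deforms_in (@crossing_change R m) n.*2 L L'.
Proof.
elim: n L => [//|n IHn] L [L2 [d [d' [Ld dd' L2d']]] L2L'].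
have [d1 [d1' [c1 iso c2]]] := delta_move_two_crossing_changes dd'; rewrite doubleS.
(* With the link of [d1] itself as the intermediate one, the isotopy to [d1'] becomes the initial
   isotopy of the second move. *)
exists (Link (in_S3_embedding d1)).
  by exists d, d1; split => //; exact: isotopic_refl.
exists L2; first by exists d1', d'.
exact: IHn.
Qed.

Local Open Scope ereal_scope.

Theorem proposition1 (R : realType) (m : nat) (L : link R m)
    (tame_L : tame L) (split_L : algebraically_split L) :
  delta_unlinking_number L >= (2^-1)%:E * unlinking_number L.
Proof.
(* It suffices to bound each attained number [n] of Delta-moves; if there is none, the infimum is
   infinite and the bound is trivial. *)
apply: le_ereal_inf_tmp => _ [n nL <-].
have /ereal_inf_lbound : [set (k%:R)%:E | k in
    [set k | deforms_in (@crossing_change R m) k L (unlink m)]] (n.*2%:R : R)%:E.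
  by exists n.*2 => //; exact: deforms_crossing_of_delta.
rewrite -(@lee_pmul2l _ (2^-1)%:E)// ?lte_fin ?invr_gt0//.
by move=> /le_trans; apply; rewrite -EFinM lee_fin -muln2 natrM mulrC mulfK.
Qed.
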